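(* For $k\ge 0$ let $r_k:=2^{6k}d_k$, where $d_k = \sum_{j=0}^{2k}(-1)^j c_j c_{2k-j}$ and $$c_m = (-1)^m\sum_{j=0}^m \,\bigl([h^{m-j}]\exp(\mu(h))\bigr)\,\frac{(m-2j+3/2)_{2j}}{4^j\, j!},\qquad \mu(h) = h^{-1} - (e^h-1)^{-1} - \tfrac12.$$ Then for all $k\ge 0$ we have $k!\,r_k\in\mathbb{Z}$.
   Context: $[h^n]$ denotes the coefficient of $h^n$ in a Maclaurin series in $h$. The function $\mu(h)$ has a removable singularity at $h=0$ with $\mu(0)=0$, so $\exp(\mu(h))$ has a Maclaurin expansion. $(x)_\ell:=x(x+1)\cdots(x+\ell-1)$ is the ascending factorial (Pochhammer symbol), $(x)_0=1$. The numbers $d_k$ are the coefficients in the Poincaré asymptotic expansion $a_nb_n\sim -\frac{1}{2n^{3/2}}\sum_{k\ge0}d_kn^{-k}$ as $n\to\infty$, where $a_n=[z^n]e^{z/(1-z)}$ and $b_n=[z^n]\bigl(e^{x}E_1(x)\bigr)$ with $x=1/(1-z)$ and $E_1(x)=\int_x^\infty e^{-t}t^{-1}\,dt$ (principal branch). *)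

(* Defs.v *)
From Stdlib Require Import Reals Factorial.
From Coquelicot Require Import Coquelicot.

Open Scope R_scope.

(* [h^n] f. [Derive_n] is total; it is the honest n-th derivative whenever
   f is smooth at 0, as exp o mu is. *)
Definition maclaurin_coeff (f : R -> R) (n : nat) : R :=
  Derive_n f n 0 / INR (fact n).

(* The value at 0 fills the removable singularity. *)
Definition mu (h : R) : R :=
  if Req_dec_T h 0 then 0 else / h - / (exp h - 1) - 1 / 2.

Fixpoint ascending_factorial (x : R) (l : nat) : R :=
  match l with
  | O => 1
  | S l' => ascending_factorial x l' * (x + INR l')
  end.

(* [sum_f_R0 f m] is the sum over 0 <= j <= m, both ends included. The base
   m - 2j + 3/2 is a real subtraction, since m - 2j may be negative. *)
Definition c (m : nat) : R :=
  (-1) ^ m *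
  sum_f_R0
    (fun j : nat =>
       maclaurin_coeff (fun h => exp (mu h)) (m - j) *
       (ascending_factorial (INR m - 2 * INR j + 3 / 2) (2 * j)
        / (4 ^ j * INR (fact j)))) m.

Definition d (k : nat) : R :=
  sum_f_R0 (fun j : nat => (-1) ^ j * c j * c (2 * k - j)) (2 * k).

Definition r (k : nat) : R := 2 ^ (6 * k) * d k.

(* Main.v *)
Require Import Defs.
From Stdlib Require Import Reals Factorial.
From Stdlib Require Import Lra Lia ZArith FunctionalExtensionality Ring.
From Coquelicot Require Import Coquelicot.

Open Scope R_scope.

(** Write [s = n ^ (-1/2)] and [x = s ^ 2 = 1 / n]. The number [(-1) ^ m * c m] is
    the coefficient of [s ^ m] in the asymptotic series, freed of the prefactor
    [sqrt PI * s ^ (3/2) * exp (- 2 / s)], of the integral over [h > 0] of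
    [exp (- n * h - 1 / h) * exp (mu h)]: the powers of [h] integrate to Bessel
    functions of the second kind. All the arguments below are about such formal
    series; an integral only motivates the map [laplace], which sends the
    coefficients of the integrand to those of the asymptotic series.

    As [exp (mu h - 1 / h)] is a constant times [exp (- 1 / (exp h - 1))], it solves
    a linear differential equation of first order whose coefficients are
    polynomials in [exp h] and [exp (- h)] ([kernel_equation]). Under the integral,
    multiplication by [exp (- h)] is the shift of [n] by one, and integration by
    parts ([laplace_by_parts]) turns the equation into a recurrence of second order
    in [n] ([shifted_recurrence]). The substitution [s -> - s] gives the other formal
    solution of this recurrence, and by definition [d k] is the coefficient of [x ^ k]
    in the product of the two. Such a product satisfies a recurrence of third order
    in [n] ([third_order_product]). The exponential prefactors cancel in it, so a
    shift of [n] by [lambda] merely replaces [n ^ (- k - 3/2)] by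
    [(n + lambda) ^ (- k - 3/2)] ([product_even]).

    Comparing coefficients yields [8 * k * d k] as a combination of the [d j] with
    [j < k] ([product_coefficient_recurrence]). Its coefficients are made of the
    numbers [binomial (- j - 3/2, i)], whose denominators divide [4 ^ i]. With
    [r k = 64 ^ k * d k] the equation becomes [k * r k] = an integral combination of
    the [r j] with [j < k] ([is_integer_scaled_transfer]), and [k! * r k] is an
    integer by induction.

    It remains to see that the Maclaurin coefficients of [exp (mu h)] satisfy the
    differential equation formally. The formal solution has a positive radius of
    convergence, and its sum agrees with [exp (mu h)] because both solve the same
    differential equation ([PSeries_kernel]). *)

(** * The ring of formal power series *)

Definition series := nat -> R.

Declare Scope series_scope.
Delimit Scope series_scope with S.
Bind Scope series_scope with series.

Definition const (a : R) : series := fun n => match n with O => a | S _ => 0 end.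
Definition add (a b : series) : series := fun n => a n + b n.
Definition opp (a : series) : series := fun n => - a n.
Definition sub (a b : series) : series := fun n => a n - b n.
Definition mul (a b : series) : series := PS_mult a b.

Notation "# a" := (const a) (at level 1, a at level 0, format "# a") : series_scope.
Notation "a + b" := (add a b) : series_scope.
Notation "a - b" := (sub a b) : series_scope.
Notation "a * b" := (mul a b) : series_scope.
Notation "- a" := (opp a) : series_scope.

Definition tail (a : series) : series := fun n => a (S n).

Lemma mul_0 (a b : series) : (a * b)%S 0%nat = a 0%nat * b 0%nat.
Proof. reflexivity. Qed.

(** Peeling off the constant term of the left factor turns each identity
    about products into an induction on the index. *)
Lemma mul_S (a b : series) n :
  (a * b)%S (S n) = a 0%nat * b (S n) + (tail a * b)%S n.
Proof. unfold mul, PS_mult. rewrite decomp_sum by lia. reflexivity. Qed.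

Lemma mul_S_r (a b : series) n :
  (a * b)%S (S n) = a (S n) * b 0%nat + (a * tail b)%S n.
Proof.
  unfold mul, PS_mult. rewrite tech5, Nat.sub_diag.
  rewrite (sum_eq _ (fun k => a k * tail b (n - k)%nat)); [ring|].
  intros i Hi. unfold tail. now rewrite Nat.sub_succ_l.
Qed.

Lemma mul_comm (a b : series) : (a * b = b * a)%S.
Proof.
  extensionality n. revert a b. induction n as [|n IH]; intros a b.
  - rewrite !mul_0. ring.
  - rewrite mul_S, mul_S_r, IH. ring.
Qed.

Lemma mul_add_l (a b e : series) : ((a + b) * e = a * e + b * e)%S.
Proof.
  extensionality n. unfold add at 2. revert a b.
  induction n as [|n IH]; intros a b.
  - rewrite !mul_0. unfold add. ring.
  - rewrite !mul_S. change (tail (a + b)%S) with (tail a + tail b)%S.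
    rewrite IH. unfold add at 1. ring.
Qed.

Lemma mul_zero_l (b : series) : (#0 * b = #0)%S.
Proof.
  extensionality n. induction n as [|n IH].
  - rewrite mul_0. simpl. ring.
  - rewrite mul_S. change (tail #0%S) with (fun _ : nat => 0).
    replace (fun _ : nat => 0) with (#0%S) by (extensionality i; now destruct i).
    rewrite IH. destruct n; simpl; ring.
Qed.

Lemma const_mul (e : R) (a : series) n : (#e * a)%S n = e * a n.
Proof.
  destruct n as [|n]; [reflexivity|].
  rewrite mul_S. replace (tail #e%S) with (#0%S).
  - rewrite mul_zero_l. destruct n; simpl; ring.
  - extensionality i. now destruct i.
Qed.

Lemma const_mul_assoc (e : R) (a b : series) : (#e * a * b = #e * (a * b))%S.
Proof.
  extensionality n. rewrite const_mul. revert a.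
  induction n as [|n IH]; intros a.
  - rewrite !mul_0. simpl. ring.
  - rewrite !mul_S. replace (tail (#e * a)%S) with (#e * tail a)%S.
    + rewrite IH, const_mul. ring.
    + extensionality i. unfold tail. now rewrite !const_mul.
Qed.

Lemma mul_assoc (a b e : series) : (a * (b * e) = a * b * e)%S.
Proof.
  extensionality n. revert a. induction n as [|n IH]; intros a.
  - rewrite !mul_0. ring.
  - rewrite !mul_S, IH.
    replace (tail (a * b)%S) with (#(a 0%nat) * tail b + tail a * b)%S.
    + rewrite mul_add_l. unfold add.
      rewrite const_mul_assoc, const_mul. rewrite mul_0. ring.
    + extensionality i. unfold add, tail at 3. now rewrite const_mul, mul_S.
Qed.

Lemma series_ring_theory :
  ring_theory (#0)%S (#1)%S add mul sub opp (@eq series).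
Proof.
  constructor; intros.
  - extensionality n. unfold add. destruct n; simpl; ring.
  - extensionality n. unfold add. ring.
  - extensionality n. unfold add. ring.
  - extensionality n. rewrite const_mul. ring.
  - apply mul_comm.
  - apply mul_assoc.
  - apply mul_add_l.
  - extensionality n. unfold sub, add, opp. ring.
  - extensionality n. unfold add, opp. destruct n; simpl; ring.
Qed.

Lemma const_add (e f : R) : (#(e + f) = #e + #f)%S.
Proof. extensionality n. unfold add. destruct n; simpl; ring. Qed.

Lemma const_mult (e f : R) : (#(e * f) = #e * #f)%S.
Proof. extensionality n. rewrite const_mul. destruct n; simpl; ring. Qed.

Lemma const_opp (e : R) : (#(- e) = - #e)%S.
Proof. extensionality n. unfold opp. destruct n; simpl; ring. Qed.

Lemma series_ring_morphism :
  ring_morph (#0)%S (#1)%S add mul sub opp (@eq series)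
    0%Z 1%Z Z.add Z.mul Z.sub Z.opp Z.eqb (fun z => const (IZR z)).
Proof.
  constructor; intros; try reflexivity.
  - now rewrite plus_IZR, const_add.
  - rewrite minus_IZR. extensionality n. unfold sub. destruct n; simpl; ring.
  - now rewrite mult_IZR, const_mult.
  - now rewrite opp_IZR, const_opp.
  - apply Z.eqb_eq in H. now subst.
Qed.

Ltac series_constant t :=
  lazymatch t with
  | const (IZR ?z) =>
      lazymatch isZcst z with
      | true => z
      | _ => constr:(InitialRing.NotConstant)
      end
  | _ => constr:(InitialRing.NotConstant)
  end.

Add Ring series_ring : series_ring_theory
  (morphism series_ring_morphism, constants [series_constant]).

(** * The operators on power series *)

Definition X : series := fun n => match n with 1%nat => 1 | _ => 0 end.
Definition deriv (a : series) : series := fun n => INR (S n) * a (S n).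
Definition euler (a : series) : series := fun n => INR n * a n.
(** Under [s -> - s] the two exponential growth rates [exp (- 2 / s)] and
    [exp (2 / s)] are exchanged. *)
Definition flip (a : series) : series := fun n => (-1) ^ n * a n.

Lemma X_mul_0 (a : series) : (X * a)%S 0%nat = 0.
Proof. rewrite mul_0. simpl. ring. Qed.

Lemma X_mul_S (a : series) n : (X * a)%S (S n) = a n.
Proof.
  rewrite mul_S. replace (tail X) with (#1%S).
  - rewrite const_mul. simpl. ring.
  - extensionality i. now destruct i.
Qed.

Lemma euler_mul (a b : series) : euler (a * b)%S = (euler a * b + a * euler b)%S.
Proof.
  extensionality n. unfold euler at 1, add. revert a b.
  induction n as [|n IH]; intros a b.
  - rewrite !mul_0. unfold euler. simpl. ring.
  - rewrite !mul_S. replace (tail (euler a)) with (euler (tail a) + tail a)%S.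
    + rewrite mul_add_l. unfold add.
      replace (INR (S n) * (a 0%nat * b (S n) + (tail a * b)%S n))
        with (INR (S n) * a 0%nat * b (S n) + INR n * (tail a * b)%S n
              + (tail a * b)%S n) by (rewrite S_INR; ring).
      rewrite IH. unfold euler. simpl. ring.
    + extensionality i. unfold add, euler, tail. rewrite S_INR. ring.
Qed.

Lemma X_deriv (a : series) : (X * deriv a)%S = euler a.
Proof.
  extensionality n. destruct n as [|n].
  - rewrite X_mul_0. unfold euler. simpl. ring.
  - now rewrite X_mul_S.
Qed.

Lemma X_mul_inj (a b : series) : (X * a = X * b)%S -> a = b.
Proof.
  intros H. extensionality n. now rewrite <- (X_mul_S a), H, X_mul_S.
Qed.

Lemma deriv_mul (a b : series) : deriv (a * b)%S = (deriv a * b + a * deriv b)%S.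
Proof.
  apply X_mul_inj. rewrite X_deriv, euler_mul, <- !X_deriv. ring.
Qed.

Lemma deriv_add (a b : series) : deriv (a + b)%S = (deriv a + deriv b)%S.
Proof. extensionality n. unfold deriv, add. ring. Qed.

Lemma flip_mul (a b : series) : flip (a * b)%S = (flip a * flip b)%S.
Proof.
  extensionality n. unfold flip at 1. revert a b.
  induction n as [|n IH]; intros a b.
  - rewrite !mul_0. unfold flip. simpl. ring.
  - rewrite !mul_S. replace (tail (flip a)) with (#(-1) * flip (tail a))%S.
    + rewrite const_mul_assoc, const_mul, <- IH. unfold flip. simpl. ring.
    + extensionality i. rewrite const_mul. unfold flip, tail. simpl. ring.
Qed.

Lemma flip_add (a b : series) : flip (a + b)%S = (flip a + flip b)%S.
Proof. extensionality n. unfold flip, add. ring. Qed.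

Lemma flip_sub (a b : series) : flip (a - b)%S = (flip a - flip b)%S.
Proof. extensionality n. unfold flip, sub. ring. Qed.

Lemma flip_const (e : R) : flip #e%S = (#e)%S.
Proof. extensionality n. unfold flip. destruct n; simpl; ring. Qed.

Lemma flip_X : flip X = (- X)%S.
Proof.
  extensionality n. unfold flip, opp. destruct n as [|[|n]]; simpl; ring.
Qed.

Lemma flip_euler (a : series) : flip (euler a) = euler (flip a).
Proof. extensionality n. unfold flip, euler. ring. Qed.

(** * The formal Laplace integral *)

(** The coefficient of [s ^ j] in the asymptotic series of the Bessel function
    of the second kind of order [p + 1] at the argument [2 / s], freed of its
    prefactor; the integral of [h ^ p * exp (- n * h - 1 / h)] is
    [2 * s ^ (p + 1)] times this function. *)
Definition bessel (p j : nat) : R :=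
  ascending_factorial (INR p - INR j + 3 / 2) (2 * j) / (4 ^ j * INR (fact j)).

(** The asymptotic series, freed of its prefactor, of the integral of
    [exp (- n * h - 1 / h) * F h]. *)
Definition laplace (F : series) : series :=
  fun n => sum_f_R0 (fun p => F p * bessel p (n - p)) n.

Lemma ascending_factorial_S_l x l :
  ascending_factorial x (S l) = x * ascending_factorial (x + 1) l.
Proof.
  induction l as [|l IH]; [simpl; ring|].
  change (ascending_factorial x (S (S l)))
    with (ascending_factorial x (S l) * (x + INR (S l))).
  rewrite IH, S_INR. simpl. ring.
Qed.

Lemma bessel_0 p : bessel p 0 = 1.
Proof. unfold bessel. simpl. field. Qed.

(** The recurrence behind [laplace_X]: the derivative of a Bessel function in
    terms of the Bessel function of the next order. *)
Lemma bessel_order_1 p j :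
  bessel (S p) (S j)
  = bessel p (S j) + (3 / 4 + 1 / 2 * INR (p + j)) * bessel p j.
Proof.
  unfold bessel. rewrite fact_simpl, mult_INR, plus_INR, !S_INR.
  replace (2 * S j)%nat with (S (S (2 * j))) by lia.
  set (x := INR p - INR j + 1 / 2).
  replace (INR p + 1 - (INR j + 1) + 3 / 2) with (x + 1) by (unfold x; field).
  replace (INR p - (INR j + 1) + 3 / 2) with x by (unfold x; field).
  replace (INR p - INR j + 3 / 2) with (x + 1) by (unfold x; field).
  rewrite (ascending_factorial_S_l x).
  set (l := (2 * j)%nat). cbn [ascending_factorial].
  rewrite S_INR. unfold l. rewrite mult_INR. simpl (INR 2). cbn [pow].
  generalize (ascending_factorial (x + 1) (2 * j)). intros a. unfold x.
  pose proof (INR_fact_neq_0 j). pose proof (pos_INR j).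
  assert (4 ^ j <> 0) by (apply pow_nonzero; lra).
  field. repeat split; trivial; lra.
Qed.

(** The recurrence of the Bessel functions in their order. *)
Lemma bessel_order_2 p j :
  bessel (S (S p)) (S j)
  = bessel p (S j) + (INR p + 2) * bessel (S p) j.
Proof.
  unfold bessel. rewrite fact_simpl, mult_INR, !S_INR.
  replace (2 * S j)%nat with (S (S (2 * j))) by lia.
  set (x := INR p - INR j + 1 / 2).
  replace (INR p + 1 + 1 - (INR j + 1) + 3 / 2) with (x + 1 + 1)
    by (unfold x; field).
  replace (INR p - (INR j + 1) + 3 / 2) with x by (unfold x; field).
  replace (INR p + 1 - INR j + 3 / 2) with (x + 1 + 1) by (unfold x; field).
  rewrite (ascending_factorial_S_l x), (ascending_factorial_S_l (x + 1)).
  set (l := (2 * j)%nat). cbn [ascending_factorial].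
  rewrite S_INR. unfold l. rewrite mult_INR. simpl (INR 2). cbn [pow].
  generalize (ascending_factorial (x + 1 + 1) (2 * j)). intros a. unfold x.
  pose proof (INR_fact_neq_0 j). pose proof (pos_INR j).
  assert (4 ^ j <> 0) by (apply pow_nonzero; lra).
  field. repeat split; trivial; lra.
Qed.

Lemma laplace_0 (F : series) : laplace F 0%nat = F 0%nat.
Proof. unfold laplace. simpl. rewrite bessel_0. ring. Qed.

Lemma laplace_add (F G : series) : laplace (F + G)%S = (laplace F + laplace G)%S.
Proof.
  extensionality n. unfold laplace, add. rewrite <- plus_sum.
  apply sum_eq. intros. ring.
Qed.

Lemma laplace_const_mul e (F : series) : laplace (#e * F)%S = (#e * laplace F)%S.
Proof.
  extensionality n. rewrite const_mul. unfold laplace. rewrite scal_sum.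
  apply sum_eq. intros. rewrite const_mul. ring.
Qed.

Lemma laplace_sub (F G : series) : laplace (F - G)%S = (laplace F - laplace G)%S.
Proof.
  replace (F - G)%S with (F + #(-1) * G)%S by ring.
  rewrite laplace_add, laplace_const_mul. ring.
Qed.

Lemma laplace_X_S (F : series) n :
  laplace (X * F)%S (S n) = sum_f_R0 (fun p => F p * bessel (S p) (n - p)) n.
Proof.
  unfold laplace. rewrite decomp_sum, X_mul_0 by lia. cbn [Nat.pred].
  rewrite Rmult_0_l, Rplus_0_l. apply sum_eq. intros p _.
  now rewrite X_mul_S.
Qed.

Definition theta (a : series) : series :=
  (X * a + X * X * (#(3 / 4) * a + #(1 / 2) * euler a))%S.

(** Multiplication by [h] under the integral is [- d/dn], which [theta] is in
    the variable [s = n ^ (-1/2)], after conjugation by the prefactor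
    [sqrt PI * s ^ (3/2) * exp (- 2 / s)]. *)
Lemma laplace_X (F : series) : laplace (X * F)%S = theta (laplace F).
Proof.
  extensionality n. unfold theta. destruct n as [|n].
  - rewrite laplace_0. unfold add. rewrite !mul_0. simpl. ring.
  - unfold add at 1. rewrite X_mul_S, laplace_X_S, <- mul_assoc, X_mul_S.
    destruct n as [|n].
    + rewrite X_mul_0. unfold laplace. simpl. rewrite !bessel_0. ring.
    + rewrite X_mul_S. unfold add. rewrite !const_mul. unfold euler, laplace.
      rewrite !tech5, !Nat.sub_diag, !bessel_0.
      rewrite (sum_eq _ (fun p => F p * bessel p (S n - p)
        + (F p * bessel p (n - p)) * (3 / 4 + 1 / 2 * INR n))).
      * rewrite plus_sum, <- scal_sum. ring.
      * intros p Hp. rewrite Nat.sub_succ_l, bessel_order_1 by lia.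
        replace (p + (n - p))%nat with n by lia. ring.
Qed.

(** Integration by parts: the integral of the derivative of
    [exp (- n * h - 1 / h) * h ^ 2 * F] vanishes. *)
Lemma laplace_by_parts (F : series) :
  laplace (X * X * F)%S = (X * X * laplace (F + deriv (X * X * F)))%S.
Proof.
  extensionality n. rewrite <- !mul_assoc. destruct n as [|n].
  - rewrite laplace_0, !X_mul_0. reflexivity.
  - rewrite X_mul_S, laplace_X_S. destruct n as [|n].
    + simpl. rewrite !X_mul_0. ring.
    + rewrite X_mul_S, laplace_add. unfold add.
      rewrite decomp_sum, X_mul_0 by lia. cbn [Nat.pred].
      replace (deriv (X * (X * F))%S)
        with (X * (fun p => (INR p + 2) * F p)%R)%S.
      * destruct n as [|n].
        -- rewrite !laplace_0, X_mul_0. cbn [sum_f_R0 Nat.sub].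
           rewrite X_mul_S, bessel_0. ring.
        -- rewrite laplace_X_S. unfold laplace. rewrite !tech5, !Nat.sub_diag.
           rewrite !X_mul_S, !bessel_0.
           rewrite (sum_eq _ (fun p => F p * bessel p (S n - p)
             + (INR p + 2) * F p * bessel (S p) (n - p))).
           ++ rewrite plus_sum. ring.
           ++ intros p Hp. rewrite X_mul_S.
              replace (S (S n) - S p)%nat with (S (n - p)) by lia.
              rewrite bessel_order_2, Nat.sub_succ_l by lia. ring.
      * extensionality p. unfold deriv. rewrite X_mul_S.
        destruct p as [|p]; rewrite ?X_mul_0, ?X_mul_S, ?S_INR; ring.
Qed.

(** * Shifts of [n] *)

Definition exps (a : R) : series := fun n => a ^ n / INR (fact n).

Lemma deriv_exps a : deriv (exps a) = (#a * exps a)%S.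
Proof.
  extensionality n. rewrite const_mul. unfold deriv, exps.
  rewrite fact_simpl, mult_INR. cbn [pow].
  pose proof (INR_fact_neq_0 n). assert (INR (S n) <> 0) by now apply not_0_INR.
  field. split; trivial.
Qed.

Lemma exps_unique a (u : series) :
  u 0%nat = 1 -> deriv u = (#a * u)%S -> u = exps a.
Proof.
  intros H0 Hd. extensionality n. induction n as [|n IH].
  - rewrite H0. unfold exps. simpl. field.
  - assert (HS : INR (S n) <> 0) by now apply not_0_INR.
    apply (Rmult_eq_reg_l (INR (S n))); trivial.
    change (deriv u n = deriv (exps a) n).
    now rewrite Hd, deriv_exps, !const_mul, IH.
Qed.

Lemma exps_mul a b : (exps a * exps b)%S = exps (a + b).
Proof.
  apply exps_unique.
  - rewrite mul_0. unfold exps. simpl. field.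
  - rewrite deriv_mul, !deriv_exps, const_add. ring.
Qed.

(** The coefficients of [(exp h - 2 + exp (- h)) / h ^ 2]. *)
Definition cosh_quotient : series := fun n => (1 + (-1) ^ n) / INR (fact (n + 2)).

Lemma X2_cosh_quotient : (X * X * cosh_quotient = exps 1 - #2 + exps (-1))%S.
Proof.
  extensionality n. rewrite <- mul_assoc. unfold add, sub.
  destruct n as [|[|n]].
  - rewrite X_mul_0. unfold exps. simpl. field.
  - rewrite X_mul_S, X_mul_0. unfold exps. simpl. field.
  - rewrite !X_mul_S. unfold cosh_quotient, exps.
    replace (n + 2)%nat with (S (S n)) by lia. rewrite pow1. cbn [pow const].
    field. apply INR_fact_neq_0.
Qed.

(** The equation of [exp (mu h)]; with the factor [exp (- 1 / h)] it reads
    [(exp h - 2 + exp (- h)) * G' = G], the equation of [exp (- 1 / (exp h - 1))]. *)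
Definition kernel_equation (E : series) : Prop :=
  (X * X * cosh_quotient * deriv E + cosh_quotient * E = E)%S.

(** The series attached to the argument [n + lambda]. *)
Definition shifted (E : series) (lambda : R) : series :=
  laplace (exps (- lambda) * E)%S.

(** The three-term recurrence of the Taylor coefficients of [exp (z / (1 - z))],
    [(n + 1) a (n + 1) - (2 n + 1) a n + (n - 1) a (n - 1) = 0], at [n + lambda]:
    multiplication by [exp h - 2 + exp (- h)] under the integral is the second
    difference in [n], and integration by parts brings in [kernel_equation]. *)
Lemma shifted_recurrence (E : series) (lambda : R) : kernel_equation E ->
  ((#1 + #lambda * (X * X))
     * (shifted E (lambda - 1) - #2 * shifted E lambda + shifted E (lambda + 1))
   = X * X * (shifted E (lambda - 1) - shifted E (lambda + 1)
              + shifted E lambda))%S.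
Proof.
  intros HE. unfold kernel_equation in HE. unfold shifted.
  set (e := exps (- lambda)).
  replace (exps (- (lambda - 1))) with (exps 1 * e)%S
    by (unfold e; rewrite exps_mul; f_equal; ring).
  replace (exps (- (lambda + 1))) with (exps (-1) * e)%S
    by (unfold e; rewrite exps_mul; f_equal; ring).
  assert (De : deriv e = (#(- lambda) * e)%S) by apply deriv_exps.
  set (D := laplace (exps 1 * e * E)). set (U := laplace (exps (-1) * e * E)).
  set (Y := laplace (e * E)).
  assert (Hsum : laplace (X * X * (cosh_quotient * e * E))%S = (D - #2 * Y + U)%S).
  { unfold D, U, Y. rewrite <- laplace_const_mul, <- laplace_sub, <- laplace_add.
    f_equal. transitivity (X * X * cosh_quotient * (e * E))%S; [ring|].
    rewrite X2_cosh_quotient. ring. }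
  assert (Hder : (cosh_quotient * e * E + deriv (X * X * (cosh_quotient * e * E))
    = exps 1 * e * E - exps (-1) * e * E
      - #lambda * (X * X * (cosh_quotient * e * E)) + e * E)%S).
  { replace (X * X * (cosh_quotient * e * E))%S
      with ((exps 1 - #2 + exps (-1)) * (e * E))%S
      by (rewrite <- X2_cosh_quotient; ring).
    replace (exps 1 - #2 + exps (-1))%S with (exps 1 + #(-2) + exps (-1))%S by ring.
    rewrite deriv_mul, !deriv_add, !deriv_exps, deriv_mul.
    rewrite De, const_opp.
    replace (deriv #(-2)%S) with (#0%S)
      by (extensionality n; unfold deriv; destruct n; simpl; ring).
    assert (HE' : ((exps 1 + #(-2) + exps (-1)) * deriv E = E - cosh_quotient * E)%S).
    { rewrite <- HE at 2.
      replace (exps 1 + #(-2) + exps (-1))%S with (exps 1 - #2 + exps (-1))%S by ring.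
      rewrite <- X2_cosh_quotient. ring. }
    transitivity (cosh_quotient * e * E + (exps 1 - exps (-1)) * (e * E)
      - #lambda * (exps 1 + #(-2) + exps (-1)) * (e * E)
      + e * ((exps 1 + #(-2) + exps (-1)) * deriv E))%S; [ring|].
    rewrite HE'. ring. }
  pose proof (laplace_by_parts (cosh_quotient * e * E)) as H.
  rewrite Hder, laplace_add, !laplace_sub, laplace_const_mul, Hsum in H.
  fold D U Y in H.
  transitivity (D - #2 * Y + U + #lambda * (X * X) * (D - #2 * Y + U))%S; [ring|].
  rewrite H at 1. ring.
Qed.

(** * The product of the two solutions *)

Definition product (E : series) (lambda : R) : series :=
  (shifted E lambda * flip (shifted E lambda))%S.

Definition family_derive (a : R -> series) (lambda : R) (b : series) : Prop :=
  forall n, is_derive (fun l => a l n) lambda (b n).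

Lemma is_derive_sum (f : nat -> R -> R) (g : nat -> R) x n :
  (forall k, is_derive (f k) x (g k)) ->
  is_derive (fun y => sum_f_R0 (fun k => f k y) n) x (sum_f_R0 g n).
Proof.
  intros H. induction n as [|n IH]; [apply H|]. simpl.
  apply (is_derive_plus (K := R_AbsRing) (V := R_NormedModule)); trivial.
Qed.

Lemma family_derive_mul a b lambda a' b' :
  family_derive a lambda a' -> family_derive b lambda b' ->
  family_derive (fun l => a l * b l)%S lambda (a' * b lambda + a lambda * b')%S.
Proof.
  intros Ha Hb n. unfold add, mul, PS_mult. rewrite <- plus_sum.
  apply is_derive_sum. intros k.
  apply (is_derive_mult (fun l => a l k) (fun l => b l (n - k)%nat));
    [apply Ha|apply Hb|exact Rmult_comm].
Qed.

Lemma family_derive_const (a : series) lambda :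
  family_derive (fun _ => a) lambda #0%S.
Proof.
  intros n. replace (#0%S n) with 0 by now destruct n.
  exact (@is_derive_const R_AbsRing R_NormedModule (a n) lambda).
Qed.

Lemma family_derive_laplace a lambda a' :
  family_derive a lambda a' ->
  family_derive (fun l => laplace (a l)) lambda (laplace a').
Proof.
  intros Ha n. apply is_derive_sum. intros k.
  apply (is_derive_ext (fun l => bessel k (n - k) * a l k)); [intros l; apply Rmult_comm|].
  rewrite Rmult_comm. apply is_derive_scal, Ha.
Qed.

Lemma family_derive_flip a lambda a' :
  family_derive a lambda a' ->
  family_derive (fun l => flip (a l)) lambda (flip a').
Proof.
  intros Ha n. unfold flip. apply is_derive_scal, Ha.
Qed.

Lemma family_derive_exps lambda :
  family_derive (fun l => exps (- l)) lambda (- (X * exps (- lambda)))%S.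
Proof.
  intros n. unfold opp. destruct n as [|n].
  - rewrite X_mul_0. unfold exps. auto_derive; trivial. simpl. ring.
  - rewrite X_mul_S. unfold exps. rewrite fact_simpl, mult_INR.
    auto_derive; trivial. cbn [Nat.pred].
    pose proof (INR_fact_neq_0 n). assert (INR (S n) <> 0) by now apply not_0_INR.
    change (match n with O => 1 | S _ => INR n + 1 end) with (INR (S n)).
    field. split; trivial.
Qed.

(** The terms [X * _] of [theta], which come from the exponential prefactors, have
    opposite signs on the two factors and cancel. What remains is [d/dn] acting on
    [s ^ 3] times a series in [s]. *)
Lemma product_derive (E : series) lambda :
  family_derive (product E) lambda
    (- (X * X * (#(3 / 2) * product E lambda
                 + #(1 / 2) * euler (product E lambda))))%S.
Proof.
  unfold product.
  assert (Hs : family_derive (shifted E) lambda (- theta (shifted E lambda))%S).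
  { unfold shifted. rewrite <- laplace_X.
    replace (- laplace (X * (exps (- lambda) * E)))%S
      with (laplace (- (X * exps (- lambda)) * E + exps (- lambda) * #0))%S.
    - apply family_derive_laplace.
      apply (family_derive_mul (fun l => exps (- l)) (fun _ => E)).
      + apply family_derive_exps.
      + apply family_derive_const.
    - replace (- (X * exps (- lambda)) * E + exps (- lambda) * #0)%S
        with (#(-1) * (X * (exps (- lambda) * E)))%S by ring.
      rewrite laplace_const_mul. ring. }
  pose proof (family_derive_mul _ _ _ _ _ Hs (family_derive_flip _ _ _ Hs)) as H.
  set (y := shifted E lambda) in *.
  replace (- (X * X * (#(3 / 2) * (y * flip y) + #(1 / 2) * euler (y * flip y))))%S
    with (- theta y * flip y + y * flip (- theta y))%S; [exact H|].
  replace (flip (- theta y))%S with (- flip (theta y))%S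
    by (extensionality n; unfold flip, opp; ring).
  unfold theta.
  rewrite euler_mul, !flip_add, !flip_mul, !flip_add, !flip_mul, !flip_const,
    !flip_X, flip_euler.
  replace (3 / 2) with (2 * (3 / 4)) by field. rewrite const_mult. ring.
Qed.

(** * The expansion of the shifted product *)

Definition rising_binomial (k i : nat) : R :=
  ascending_factorial (INR k + 3 / 2) i / INR (fact i).

(** The coefficients of [(1 + lambda * x) ^ (- k - 3/2)], which is
    [(n + lambda) ^ (- k - 3/2)] divided by [n ^ (- k - 3/2)], at [x = 1 / n]. *)
Definition shift_expansion (lambda : R) (k : nat) : series :=
  fun i => (- lambda) ^ i * rising_binomial k i.

(** The expansion of [n ^ (3/2)] times the sum of the
    [e k * (n + lambda) ^ (- k - 3/2)], if [G] is [shift_expansion lambda]. *)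
Definition superpose (e : nat -> R) (G : nat -> series) : series :=
  fun K => sum_f_R0 (fun k => e k * G k (K - k)%nat) K.

Lemma superpose_add e G H :
  superpose e (fun k => G k + H k)%S = (superpose e G + superpose e H)%S.
Proof.
  extensionality K. unfold superpose, add. rewrite <- plus_sum.
  apply sum_eq. intros. ring.
Qed.

Lemma superpose_const_mul e f G :
  superpose e (fun k => #f * G k)%S = (#f * superpose e G)%S.
Proof.
  extensionality K. rewrite const_mul. unfold superpose. rewrite scal_sum.
  apply sum_eq. intros. rewrite const_mul. ring.
Qed.

Lemma superpose_X e G : superpose e (fun k => X * G k)%S = (X * superpose e G)%S.
Proof.
  extensionality K. unfold superpose. destruct K as [|K].
  - simpl. rewrite !X_mul_0. ring.
  - rewrite X_mul_S, tech5, Nat.sub_diag, X_mul_0, Rmult_0_r, Rplus_0_r.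
    apply sum_eq. intros k Hk. now rewrite Nat.sub_succ_l, X_mul_S.
Qed.

Lemma rising_binomial_S k i :
  INR (S i) * rising_binomial k (S i) = (INR k + 3 / 2 + INR i) * rising_binomial k i.
Proof.
  unfold rising_binomial. rewrite fact_simpl, mult_INR. simpl ascending_factorial.
  pose proof (INR_fact_neq_0 i). assert (INR (S i) <> 0) by now apply not_0_INR.
  field. split; trivial.
Qed.

Lemma shift_expansion_derive k i lambda :
  is_derive (fun l => shift_expansion l k (S i)) lambda
    (- (INR k + 3 / 2 + INR i) * shift_expansion lambda k i).
Proof.
  unfold shift_expansion.
  replace (- (INR k + 3 / 2 + INR i) * ((- lambda) ^ i * rising_binomial k i))
    with (- (- lambda) ^ i * (INR (S i) * rising_binomial k (S i)))
    by (rewrite rising_binomial_S; ring).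
  generalize (rising_binomial k (S i)). intros b.
  auto_derive; trivial. cbn [Nat.pred].
  change (match i with O => 1 | S _ => INR i + 1 end) with (INR (S i)). ring.
Qed.

Lemma shift_expansion_0 lambda k : shift_expansion lambda k 0%nat = 1.
Proof. unfold shift_expansion, rising_binomial. simpl. field. Qed.

Lemma eq_of_same_derive (f g h : R -> R) x :
  (forall t, is_derive f t (h t)) -> (forall t, is_derive g t (h t)) ->
  f 0 = g 0 -> f x = g x.
Proof.
  intros Hf Hg H0.
  assert (Hd : forall t, is_derive (fun u => f u - g u) t 0).
  { intros t. replace 0 with (h t - h t) by ring.
    apply (is_derive_minus (K := R_AbsRing) (V := R_NormedModule)); trivial. }
  destruct (MVT_gen (fun u => f u - g u) 0 x (fun _ => 0)) as [t [_ Ht]].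
  - intros t _. apply Hd.
  - intros t _. apply derivable_continuous_pt. exists 0. apply is_derive_Reals, Hd.
  - lra.
Qed.

(** Shifting [n] in the product acts termwise on the powers [n ^ (- k - 3/2)]: both
    sides satisfy the same triangular system of differential equations in
    [lambda], that of [product_derive], and agree at [lambda = 0]. *)
Lemma product_even (E : series) lambda K :
  product E lambda (2 * K)%nat
  = superpose (fun k => product E 0 (2 * k)%nat) (shift_expansion lambda) K.
Proof.
  revert lambda. induction K as [|K IH]; intros lambda.
  - unfold superpose. simpl sum_f_R0. rewrite shift_expansion_0.
    change (2 * 0)%nat with 0%nat.
    apply (eq_of_same_derive (fun l => product E l 0%nat)
             (fun _ => product E 0 0%nat * 1) (fun _ => 0)); [| |ring].
    + intros t. pose proof (product_derive E t 0%nat) as H.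
      unfold opp in H. rewrite <- mul_assoc, X_mul_0 in H.
      now rewrite Ropp_0 in H.
    + intros t. exact (@is_derive_const R_AbsRing R_NormedModule _ t).
  - apply (eq_of_same_derive (fun l => product E l (2 * S K)%nat)
      (fun l => superpose (fun k => product E 0 (2 * k)%nat) (shift_expansion l) (S K))
      (fun l => - (INR K + 3 / 2) * product E l (2 * K)%nat)).
    + intros t. pose proof (product_derive E t (2 * S K)%nat) as H.
      replace (2 * S K)%nat with (S (S (2 * K))) in * by lia.
      unfold opp in H. rewrite <- mul_assoc, !X_mul_S in H.
      unfold add in H. rewrite !const_mul in H. unfold euler in H.
      rewrite mult_INR in H. simpl (INR 2) in H.
      replace (- (INR K + 3 / 2) * product E t (2 * K)%nat)
        with (- (3 / 2 * product E t (2 * K)%nat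
              + 1 / 2 * ((1 + 1) * INR K * product E t (2 * K)%nat))) by field.
      exact H.
    + intros t. rewrite IH. unfold superpose.
      apply (is_derive_ext (fun l =>
        sum_f_R0 (fun k => product E 0 (2 * k)%nat * shift_expansion l k (S (K - k))%nat) K
        + product E 0 (2 * S K)%nat)).
      * intros l. rewrite tech5, Nat.sub_diag, shift_expansion_0, Rmult_1_r.
        f_equal. apply sum_eq. intros k Hk. now rewrite Nat.sub_succ_l.
      * rewrite scal_sum, <- (Rplus_0_r (sum_f_R0 _ _)).
        apply (is_derive_plus (K := R_AbsRing) (V := R_NormedModule));
          [|exact (@is_derive_const R_AbsRing R_NormedModule _ t)].
        rewrite (sum_eq _ (fun k => product E 0 (2 * k)%nat
          * (- (INR k + 3 / 2 + INR (K - k)) * shift_expansion t k (K - k)%nat))).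
        -- apply is_derive_sum. intros k. apply is_derive_scal, shift_expansion_derive.
        -- intros k Hk. rewrite minus_INR by assumption. ring.
    + unfold superpose. rewrite tech5, Nat.sub_diag, shift_expansion_0, sum_eq_R0; [ring|].
      intros k Hk. rewrite Nat.sub_succ_l by assumption.
      unfold shift_expansion. rewrite Ropp_0. simpl. ring.
Qed.

(** * The recurrence for the coefficients of the product *)

(** The third-order relation between the values [a_], [a0], [a1], [a2] at
    [n - 1], ..., [n + 2] of a product of two solutions of the three-term
    recurrence, multiplied by [x ^ 4], for [x = 1 / n]. *)
Definition third_order (x a_ a0 a1 a2 : series) : series :=
  ((#1 + x) * (#2 + x)
     * ((#2 + #3 * x) * (#2 + #3 * x) * a1 + a0 - (#1 + #2 * x) * (#1 + #2 * x) * a2)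
   + (#2 + #3 * x)
     * ((#2 + x) * (#2 + x) * a0 + (#1 - x) * (#1 - x) * a_ - (#1 + x) * (#1 + x) * a1)
   - #2 * (#2 + x) * (#2 + x) * (#2 + #3 * x) * a0)%S.

(** In this form the relation uses only sums, scalar multiples and
    multiplication by [x], which [even_part] and [superpose] respect. *)
Lemma third_order_horner (x a_ a0 a1 a2 : series) :
  third_order x a_ a0 a1 a2
  = (#2 * a_ + #(-6) * a0 + #6 * a1 + #(-2) * a2
     + x * (#(-1) * a_ + #(-17) * a0 + #29 * a1 + #(-11) * a2
     + x * (#(-4) * a_ + #(-13) * a0 + #50 * a1 + #(-21) * a2
     + x * (#3 * a_ + #(-3) * a0 + #36 * a1 + #(-16) * a2
     + x * (#9 * a1 + #(-4) * a2)))))%S.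
Proof. unfold third_order. ring. Qed.

(** Eliminating the mixed product [y0 * z_ + y_ * z0] and its shift
    [y1 * z0 + y0 * z1] between the two recurrences. *)
Lemma third_order_product (x y_ y0 y1 y2 z_ z0 z1 z2 : series) :
  ((#1 + x) * y1 = (#2 + x) * y0 - (#1 - x) * y_)%S ->
  ((#1 + x) * z1 = (#2 + x) * z0 - (#1 - x) * z_)%S ->
  ((#1 + #2 * x) * y2 = (#2 + #3 * x) * y1 - y0)%S ->
  ((#1 + #2 * x) * z2 = (#2 + #3 * x) * z1 - z0)%S ->
  third_order x (y_ * z_)%S (y0 * z0)%S (y1 * z1)%S (y2 * z2)%S = #0%S.
Proof.
  intros Hy1 Hz1 Hy2 Hz2. unfold third_order.
  replace ((#1 + #2 * x) * (#1 + #2 * x) * (y2 * z2))%S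
    with (((#1 + #2 * x) * y2) * ((#1 + #2 * x) * z2))%S by ring.
  replace ((#1 + x) * (#1 + x) * (y1 * z1))%S
    with (((#1 + x) * y1) * ((#1 + x) * z1))%S by ring.
  rewrite Hy2, Hz2, Hy1, Hz1.
  transitivity ((#2 + x) * (#2 + #3 * x)
    * (((#1 + x) * y1) * z0 + y0 * ((#1 + x) * z1)
       + (#1 - x) * (y0 * z_ + y_ * z0) - #2 * (#2 + x) * (y0 * z0)))%S; [ring|].
  rewrite Hy1, Hz1. ring.
Qed.

Lemma product_third_order (E : series) : kernel_equation E ->
  third_order (X * X)%S (product E (-1)) (product E 0) (product E 1) (product E 2)
  = #0%S.
Proof.
  intros HE.
  pose proof (shifted_recurrence E 0 HE) as H0.
  pose proof (shifted_recurrence E 1 HE) as H1.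
  replace (0 - 1) with (-1) in H0 by ring. replace (0 + 1) with 1 in H0 by ring.
  replace (1 - 1) with 0 in H1 by ring. replace (1 + 1) with 2 in H1 by ring.
  unfold product. generalize dependent (shifted E (-1)). intros y_.
  generalize dependent (shifted E 0). intros y0.
  generalize dependent (shifted E 1). intros y1.
  generalize dependent (shifted E 2). intros y2. intros H1 H0.
  assert (K0 : ((#1 + X * X) * y1 = (#2 + X * X) * y0 - (#1 - X * X) * y_)%S).
  { transitivity ((#1 + #0 * (X * X)) * (y_ - #2 * y0 + y1)
      + #2 * y0 - y_ + X * X * y1)%S; [ring|]. rewrite H0. ring. }
  assert (K1 : ((#1 + #2 * (X * X)) * y2 = (#2 + #3 * (X * X)) * y1 - y0)%S).
  { transitivity ((#1 + #1 * (X * X)) * (y0 - #2 * y1 + y2)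
      + (#2 + #2 * (X * X)) * y1 - (#1 + X * X) * y0 + X * X * y2)%S; [ring|].
    rewrite H1. ring. }
  assert (HX : (- X * - X = X * X)%S) by ring.
  apply third_order_product; trivial.
  - apply (f_equal flip) in K0. revert K0.
    now rewrite !flip_sub, !flip_mul, !flip_add, !flip_sub, !flip_mul, !flip_const,
      !flip_X, HX.
  - apply (f_equal flip) in K1. revert K1.
    now rewrite !flip_sub, !flip_mul, !flip_add, !flip_mul, !flip_const, !flip_X, HX.
Qed.

Definition even_part (a : series) : series := fun k => a (2 * k)%nat.

Lemma even_part_X2 (a : series) : even_part (X * X * a)%S = (X * even_part a)%S.
Proof.
  extensionality k. unfold even_part. rewrite <- mul_assoc. destruct k as [|k].
  - now rewrite !X_mul_0.
  - replace (2 * S k)%nat with (S (S (2 * k))) by lia. now rewrite !X_mul_S.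
Qed.

Lemma even_part_add (a b : series) :
  even_part (a + b)%S = (even_part a + even_part b)%S.
Proof. reflexivity. Qed.

Lemma even_part_const_mul e (a : series) :
  even_part (#e * a)%S = (#e * even_part a)%S.
Proof. extensionality k. rewrite const_mul. unfold even_part. apply const_mul. Qed.

(** [transfer k i] is the factor with which the coefficient of [x ^ k] in
    the product enters the coefficient of [x ^ (k + i)] in the third-order relation. *)
Definition transfer (k : nat) : series :=
  third_order X (shift_expansion (-1) k) (shift_expansion 0 k)
    (shift_expansion 1 k) (shift_expansion 2 k).

Lemma superpose_transfer (E : series) : kernel_equation E ->
  superpose (fun k => product E 0 (2 * k)%nat) transfer = #0%S.
Proof.
  intros HE. transitivity (even_part #0%S).
  - rewrite <- (product_third_order E HE), third_order_horner.
    rewrite ?even_part_add, ?even_part_X2, ?even_part_add, ?even_part_X2,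
      ?even_part_add, ?even_part_X2, ?even_part_add, ?even_part_X2,
      ?even_part_add, !even_part_const_mul.
    assert (Heven : forall lambda, even_part (product E lambda)
      = superpose (fun k => product E 0 (2 * k)%nat) (shift_expansion lambda))
      by (intros; extensionality K; apply product_even).
    rewrite !Heven, <- ?superpose_const_mul, <- ?superpose_add, <- ?superpose_X,
      <- ?superpose_add, <- ?superpose_X, <- ?superpose_add, <- ?superpose_X,
      <- ?superpose_add, <- ?superpose_X, <- ?superpose_add.
    f_equal. extensionality k. apply third_order_horner.
  - extensionality k. unfold even_part. destruct k; reflexivity.
Qed.

(** * Integrality *)

Definition is_integer (x : R) : Prop := exists z : Z, x = IZR z.

Lemma is_integer_IZR z : is_integer (IZR z).
Proof. now exists z. Qed.

Lemma is_integer_INR n : is_integer (INR n).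
Proof. exists (Z.of_nat n). apply INR_IZR_INZ. Qed.

Lemma is_integer_add x y : is_integer x -> is_integer y -> is_integer (x + y).
Proof. intros [a ->] [b ->]. exists (a + b)%Z. now rewrite plus_IZR. Qed.

Lemma is_integer_mul x y : is_integer x -> is_integer y -> is_integer (x * y).
Proof. intros [a ->] [b ->]. exists (a * b)%Z. now rewrite mult_IZR. Qed.

Lemma is_integer_pow x n : is_integer x -> is_integer (x ^ n).
Proof.
  intros Hx. induction n as [|n IH].
  - apply (is_integer_IZR 1).
  - now apply is_integer_mul.
Qed.

Lemma is_integer_sum (f : nat -> R) n :
  (forall k, (k <= n)%nat -> is_integer (f k)) -> is_integer (sum_f_R0 f n).
Proof.
  intros H. induction n as [|n IH]; simpl.
  - now apply H.
  - apply is_integer_add; [apply IH; intros; apply H; lia | now apply H].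
Qed.

Lemma is_integer_binomial n k : (k <= n)%nat -> is_integer (Binomial.C n k).
Proof.
  revert k. induction n as [|n IH]; intros k Hk.
  - replace k with 0%nat by lia. rewrite Binomial.pascal_step1 by lia.
    unfold Binomial.C. simpl. replace (1 / (1 * 1)) with 1 by field.
    apply (is_integer_IZR 1).
  - assert (Hn : forall m, is_integer (Binomial.C m 0)).
    { intros m. unfold Binomial.C. rewrite Nat.sub_0_r. simpl (INR (fact 0)).
      replace (INR (fact m) / (1 * INR (fact m))) with 1
        by (field; apply INR_fact_neq_0).
      apply (is_integer_IZR 1). }
    destruct k as [|k]; [apply Hn|].
    destruct (Nat.eq_dec k n) as [->|Hkn].
    + rewrite Binomial.pascal_step1, Nat.sub_diag by lia. apply Hn.
    + rewrite <- Binomial.pascal by lia. apply is_integer_add; apply IH; lia.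
Qed.

Lemma is_integer_fact_ratio p q :
  is_integer (INR (fact (p + q)) / INR (fact p)).
Proof.
  induction q as [|q IH].
  - rewrite Nat.add_0_r. unfold Rdiv. rewrite Rinv_r by apply INR_fact_neq_0.
    apply (is_integer_IZR 1).
  - rewrite Nat.add_succ_r, fact_simpl, mult_INR. unfold Rdiv.
    rewrite Rmult_assoc. apply is_integer_mul; [apply is_integer_INR|exact IH].
Qed.

(** Pascal's rule moves the base from [x] to [x + 1]; at [x = 1/2] the numbers
    are the central binomial coefficients. *)
Lemma is_integer_rising_binomial k i : is_integer (4 ^ i * rising_binomial k i).
Proof.
  assert (Hstep : forall x,
    (forall i, is_integer (4 ^ i * (ascending_factorial x i / INR (fact i)))) ->
    forall i, is_integer (4 ^ i * (ascending_factorial (x + 1) i / INR (fact i)))).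
  { intros x Hx j. induction j as [|j IH]; [exact (Hx 0%nat)|].
    replace (4 ^ S j * (ascending_factorial (x + 1) (S j) / INR (fact (S j))))
      with (4 ^ S j * (ascending_factorial x (S j) / INR (fact (S j)))
            + 4 * (4 ^ j * (ascending_factorial (x + 1) j / INR (fact j)))).
    - apply is_integer_add; [apply Hx|].
      apply is_integer_mul; [apply (is_integer_IZR 4)|exact IH].
    - rewrite ascending_factorial_S_l, fact_simpl, mult_INR.
      simpl ascending_factorial. rewrite S_INR. cbn [pow].
      pose proof (INR_fact_neq_0 j). pose proof (pos_INR j).
      field. split; trivial; lra. }
  revert i. unfold rising_binomial. induction k as [|k IH].
  - replace (INR 0 + 3 / 2) with (1 / 2 + 1) by (simpl; field).
    apply Hstep. intros i.
    replace (4 ^ i * (ascending_factorial (1 / 2) i / INR (fact i)))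
      with (Binomial.C (2 * i) i); [apply is_integer_binomial; lia|].
    unfold Binomial.C. replace (2 * i - i)%nat with i by lia.
    pose proof (INR_fact_neq_0 i).
    enough (H2 : INR (fact (2 * i))
                 = 4 ^ i * ascending_factorial (1 / 2) i * INR (fact i))
      by (rewrite H2; field; trivial).
    clear. induction i as [|i IH]; [simpl; ring|].
    replace (2 * S i)%nat with (S (S (2 * i))) by lia.
    rewrite !fact_simpl, !mult_INR, IH, !S_INR, mult_INR.
    simpl ascending_factorial. simpl (INR 2). cbn [pow]. field.
  - intros i. replace (INR (S k) + 3 / 2) with (INR k + 3 / 2 + 1)
      by (rewrite S_INR; ring).
    now apply Hstep.
Qed.

Lemma is_integer_shift_expansion z k i n : (i <= n)%nat ->
  is_integer (4 ^ n * shift_expansion (IZR z) k i).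
Proof.
  intros Hi. unfold shift_expansion.
  replace n with (n - i + i)%nat by lia. rewrite pow_add.
  replace (4 ^ (n - i) * 4 ^ i * ((- IZR z) ^ i * rising_binomial k i))
    with (4 ^ (n - i) * ((- IZR z) ^ i * (4 ^ i * rising_binomial k i))) by ring.
  apply is_integer_mul; [|apply is_integer_mul].
  - apply is_integer_pow, (is_integer_IZR 4).
  - rewrite <- opp_IZR. apply is_integer_pow, is_integer_IZR.
  - apply is_integer_rising_binomial.
Qed.

Lemma transfer_0 k : transfer k 0%nat = 0.
Proof.
  unfold transfer. rewrite third_order_horner.
  unfold add. rewrite !X_mul_0, !const_mul, !shift_expansion_0. ring.
Qed.

Lemma transfer_1 k : transfer k 1%nat = 0.
Proof.
  unfold transfer. rewrite third_order_horner.
  unfold add. rewrite !X_mul_S, !X_mul_0, !const_mul, !shift_expansion_0.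
  unfold shift_expansion, rising_binomial. simpl. field.
Qed.

(** The first coefficient that does not vanish identically; its factor [k] is the
    source of [k!] in the theorem. *)
Lemma transfer_2 k : transfer k 2%nat = - 8 * INR k.
Proof.
  unfold transfer. rewrite third_order_horner.
  unfold add. rewrite !X_mul_S, !X_mul_0, !const_mul, !shift_expansion_0.
  unfold shift_expansion, rising_binomial. simpl. field.
Qed.

Lemma transfer_3 k :
  8 * transfer k 3%nat
  = 2 * (2 * INR k + 3) * (2 * INR k + 5) * (2 * INR k + 7)
    - 16 * (2 * INR k + 3) * (2 * INR k + 5) - 48 * (2 * INR k + 3) + 160.
Proof.
  unfold transfer. rewrite third_order_horner.
  unfold add. rewrite !X_mul_S, !X_mul_0, !const_mul, !shift_expansion_0.
  unfold shift_expansion, rising_binomial. simpl. field.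
Qed.

Lemma is_integer_transfer k n : is_integer (4 ^ (n + 4) * transfer k (n + 4)%nat).
Proof.
  unfold transfer. rewrite third_order_horner.
  replace (n + 4)%nat with (S (S (S (S n)))) by lia.
  unfold add. rewrite !X_mul_S, !const_mul.
  rewrite !Rmult_plus_distr_l.
  assert (H : forall e z i, (i <= S (S (S (S n))))%nat ->
    is_integer (4 ^ S (S (S (S n))) * (IZR e * shift_expansion (IZR z) k i))).
  { intros e z i Hi. rewrite <- Rmult_assoc, (Rmult_comm _ (IZR e)), Rmult_assoc.
    apply is_integer_mul; [apply is_integer_IZR|].
    now apply is_integer_shift_expansion. }
  repeat apply is_integer_add; apply H; lia.
Qed.

(** For [m = 0] the bound [4 ^ 3] on the denominator of [transfer k 3] is too
    weak: the explicit value shows that it divides [8]. *)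
Lemma is_integer_scaled_transfer k m :
  is_integer (64 ^ S m * transfer k (m + 3)%nat / 8).
Proof.
  destruct m as [|m].
  - replace (64 ^ 1 * transfer k (0 + 3)%nat / 8) with (8 * transfer k 3%nat)
      by (simpl; field).
    rewrite transfer_3, INR_IZR_INZ. set (K := Z.of_nat k).
    exists (2 * (2 * K + 3) * (2 * K + 5) * (2 * K + 7)
      - 16 * (2 * K + 3) * (2 * K + 5) - 48 * (2 * K + 3) + 160)%Z.
    now rewrite !plus_IZR, !minus_IZR, !mult_IZR, !plus_IZR, !mult_IZR.
  - replace (S m + 3)%nat with (m + 4)%nat by lia.
    replace (64 ^ S (S m) * transfer k (m + 4)%nat / 8)
      with (2 * 16 ^ m * (4 ^ (m + 4) * transfer k (m + 4)%nat)).
    + apply is_integer_mul; [|apply is_integer_transfer].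
      apply is_integer_mul; [apply (is_integer_IZR 2)|].
      apply is_integer_pow, (is_integer_IZR 16).
    + cbn [pow]. rewrite pow_add. replace 64 with (16 * 4) by ring.
      rewrite Rpow_mult_distr. simpl (4 ^ 4). field.
Qed.

(** The coefficient of [x ^ (k + 3)] in the third-order relation. *)
Lemma product_coefficient_recurrence (E : series) k : kernel_equation E ->
  8 * INR (S k) * product E 0 (2 * S k)%nat
  = sum_f_R0 (fun j => product E 0 (2 * j)%nat * transfer j (k - j + 3)%nat) k.
Proof.
  intros HE. pose proof (superpose_transfer E HE) as H.
  apply (f_equal (fun a => a (S (S (S k))))) in H.
  unfold superpose in H. rewrite !tech5 in H. cbn [const] in H.
  replace (S (S (S k)) - S k)%nat with 2%nat in H by lia.
  replace (S (S (S k)) - S (S k))%nat with 1%nat in H by lia.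
  rewrite Nat.sub_diag, transfer_0, transfer_1, transfer_2 in H.
  rewrite (sum_eq _ (fun j => product E 0 (2 * j)%nat * transfer j (k - j + 3)%nat))
    in H; [lra|].
  intros j Hj. do 2 f_equal. lia.
Qed.

Lemma is_integer_scaled_product (E : series) : kernel_equation E -> E 0%nat = 1 ->
  forall k, is_integer (INR (fact k) * (64 ^ k * product E 0 (2 * k)%nat)).
Proof.
  intros HE HE0 k. induction k as [k IH] using (well_founded_induction lt_wf).
  destruct k as [|k].
  - replace (product E 0 (2 * 0)%nat) with 1;
      [simpl; rewrite !Rmult_1_r; apply (is_integer_IZR 1)|].
    unfold product. change (2 * 0)%nat with 0%nat. rewrite mul_0. unfold flip, shifted.
    rewrite laplace_0, mul_0, HE0. unfold exps. simpl. field.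
  - replace (INR (fact (S k)) * (64 ^ S k * product E 0 (2 * S k)%nat))
      with (INR (fact k) * 64 ^ S k / 8 * (8 * INR (S k) * product E 0 (2 * S k)%nat))
      by (rewrite fact_simpl, mult_INR; field).
    rewrite product_coefficient_recurrence, scal_sum by exact HE.
    apply is_integer_sum. intros j Hj.
    replace (product E 0 (2 * j)%nat * transfer j (k - j + 3)%nat
             * (INR (fact k) * 64 ^ S k / 8))
      with (INR (fact (j + (k - j))) / INR (fact j)
            * (INR (fact j) * (64 ^ j * product E 0 (2 * j)%nat))
            * (64 ^ S (k - j) * transfer j (k - j + 3)%nat / 8)).
    + apply is_integer_mul; [apply is_integer_mul|].
      * apply is_integer_fact_ratio.
      * apply IH. lia.
      * apply is_integer_scaled_transfer.
    + replace (j + (k - j))%nat with k by lia.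
      replace (S k) with (j + S (k - j))%nat by lia. rewrite pow_add.
      field. apply INR_fact_neq_0.
Qed.

(** [shifted E 0] has the coefficients [(-1) ^ m * c m], so the signs in [d] are
    those of [flip]. *)
Lemma product_d (E : series) k :
  (forall n, E n = maclaurin_coeff (fun h => exp (mu h)) n) ->
  d k = product E 0 (2 * k)%nat.
Proof.
  intros HE.
  assert (Hc : forall m, shifted E 0 m = (-1) ^ m * c m).
  { intros m. unfold shifted. replace (exps (- 0) * E)%S with E.
    - unfold c. rewrite <- Rmult_assoc, <- pow_add.
      replace ((-1) ^ (m + m)) with 1
        by (replace (m + m)%nat with (2 * m)%nat by lia; now rewrite pow_1_even).
      rewrite Rmult_1_l. unfold laplace.
      (* Commuting a series with the all-ones series reverses its partial sums. *)
      pose (f := fun p => E p * bessel p (m - p)).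
      transitivity ((f * (fun _ => 1%R))%S m).
      + unfold mul, PS_mult. apply sum_eq. intros. unfold f. ring.
      + rewrite mul_comm. unfold mul, PS_mult. apply sum_eq. intros j Hj.
        unfold f, bessel. replace (m - (m - j))%nat with j by lia.
        rewrite HE, Rmult_1_l, minus_INR by assumption. do 3 f_equal. ring.
    - replace (exps (- 0)) with (#1)%S; [ring|].
      extensionality n. unfold exps. rewrite Ropp_0.
      destruct n as [|n]; simpl; [field|]. rewrite Rmult_0_l. unfold Rdiv. ring. }
  unfold product, d, mul, PS_mult. apply sum_eq. intros j Hj.
  unfold flip. rewrite !Hc. rewrite <- (Rmult_assoc ((-1) ^ (2 * k - j))), <- pow_add.
  replace (2 * k - j + (2 * k - j))%nat with (2 * (2 * k - j))%nat by lia.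
  rewrite pow_1_even. ring.
Qed.

(** * The Maclaurin coefficients of [exp (mu h)] *)

(** Iterating [Phi] from any series stabilizes coefficient by coefficient, as
    each one depends on the preceding ones only. *)
Lemma causal_fixpoint (Phi : series -> nat -> R) (e : R) :
  (forall u v n, (forall i, (i <= n)%nat -> u i = v i) -> Phi u n = Phi v n) ->
  exists E : series, E 0%nat = e /\ forall n, E (S n) = Phi E n.
Proof.
  intros HPhi.
  pose (step := fun (u : series) n => match n with O => e | S m => Phi u m end).
  pose (it := fun N => Nat.iter N step (const e)).
  assert (Hst : forall n N M, (n <= N)%nat -> (n <= M)%nat -> it N n = it M n).
  { intros n. induction n as [n IH] using (well_founded_induction lt_wf).
    intros N M HN HM. destruct n as [|n].
    - now destruct N, M.
    - destruct N as [|N]; [lia|]. destruct M as [|M]; [lia|].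
      apply HPhi. intros i Hi. apply IH; lia. }
  exists (fun n => it n n). split; [reflexivity|].
  intros n. apply HPhi. intros i Hi. apply Hst; lia.
Qed.

Lemma mul_agree (a u v : series) n :
  (forall i, (i <= n)%nat -> u i = v i) -> (a * u)%S n = (a * v)%S n.
Proof.
  intros H. unfold mul, PS_mult. apply sum_eq. intros i Hi. rewrite H; [ring|lia].
Qed.

(** The bound is the sum of the geometric progression [M * 3 ^ i]. *)
Lemma mul_bound (a b : series) M n :
  (forall i, Rabs (a i) <= 1) -> (forall i, (i <= n)%nat -> Rabs (b i) <= M * 3 ^ i) ->
  Rabs ((a * b)%S n) <= M * (3 ^ S n - 1) / 2.
Proof.
  revert a. induction n as [|n IH]; intros a Ha Hb.
  - rewrite mul_0, Rabs_mult. pose proof (Ha 0%nat).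
    pose proof (Hb 0%nat (le_n _)) as H0. simpl in *.
    pose proof (Rabs_pos (a 0%nat)). pose proof (Rabs_pos (b 0%nat)). nra.
  - rewrite mul_S. eapply Rle_trans; [apply Rabs_triang|].
    assert (H1 : Rabs (a 0%nat * b (S n)) <= M * 3 ^ S n).
    { rewrite Rabs_mult. pose proof (Ha 0%nat). pose proof (Hb (S n) (le_n _)).
      pose proof (Rabs_pos (a 0%nat)). pose proof (Rabs_pos (b (S n))). nra. }
    assert (H2 : Rabs ((tail a * b)%S n) <= M * (3 ^ S n - 1) / 2).
    { apply IH; [intros i; apply Ha|]. intros i Hi. apply Hb. lia. }
    simpl in *. lra.
Qed.

Lemma cosh_quotient_bound n : Rabs (cosh_quotient n) <= 1.
Proof.
  unfold cosh_quotient.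
  assert (Hf : 2 <= INR (fact (n + 2))).
  { apply (le_INR 2). apply (fact_le 2). lia. }
  assert (Hs : -1 <= (-1) ^ n <= 1).
  { apply Rabs_le_between. rewrite pow_1_abs. lra. }
  apply Rabs_le. split.
  - apply (Rmult_le_reg_r (INR (fact (n + 2)))); [lra|]. field_simplify; lra.
  - apply (Rmult_le_reg_r (INR (fact (n + 2)))); [lra|]. field_simplify; lra.
Qed.

Lemma cosh_quotient_tail :
  cosh_quotient = (#1 + X * (X * tail (tail cosh_quotient)))%S.
Proof.
  extensionality n. unfold add. destruct n as [|[|n]].
  - rewrite X_mul_0. unfold cosh_quotient. simpl. field.
  - rewrite X_mul_S, X_mul_0. unfold cosh_quotient. simpl. field.
  - rewrite !X_mul_S. unfold tail. simpl const. ring.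
Qed.

(** As [cosh_quotient] is [1 + O (h ^ 2)], [kernel_equation] can be divided by
    [h ^ 2]. The result is regular at [0] and determines its solution from the
    value at [0]. The rate [3] suffices for the growth, since the
    convolution of a sequence bounded by [1] with [3 ^ i] is at most [3 ^ (n + 1) / 2]. *)
Lemma kernel_solution : exists E : series,
  E 0%nat = 1 /\
  (cosh_quotient * deriv E = - (tail (tail cosh_quotient) * E))%S /\
  forall n, Rabs (E n) <= 3 ^ n.
Proof.
  pose (w := tail (tail cosh_quotient)). pose (p := (X * w)%S).
  destruct (causal_fixpoint
    (fun E n => - ((X * (p * deriv E))%S n + (w * E)%S n) / INR (S n)) 1)
    as [E [HE0 HES]].
  { intros u v n H. do 3 f_equal.
    - destruct n as [|n]; [now rewrite !X_mul_0|]. rewrite !X_mul_S.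
      apply mul_agree. intros i Hi. unfold deriv. rewrite H; [ring|lia].
    - now apply mul_agree. }
  assert (Hp : forall i, Rabs (p i) <= 1).
  { intros i. unfold p. destruct i as [|i].
    - rewrite X_mul_0, Rabs_R0. lra.
    - rewrite X_mul_S. apply cosh_quotient_bound. }
  exists E. split; [exact HE0|split].
  - fold w. replace cosh_quotient with (#1 + X * p)%S
      by (symmetry; exact cosh_quotient_tail).
    assert (H : deriv E = (- (X * (p * deriv E) + w * E))%S).
    { extensionality n. unfold deriv at 1. rewrite HES. unfold opp, add. field.
      now apply not_0_INR. }
    transitivity (deriv E + X * (p * deriv E))%S; [ring|].
    rewrite H at 1. ring.
  - intros n. induction n as [n IH] using (well_founded_induction lt_wf).
    destruct n as [|n]; [rewrite HE0, Rabs_R1; simpl; lra|].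
    rewrite HES. unfold Rdiv. rewrite Rabs_mult, Rabs_Ropp.
    assert (Hn : 0 < INR (S n)) by (apply lt_0_INR; lia).
    rewrite Rabs_inv, (Rabs_pos_eq (INR (S n))) by lra.
    apply (Rmult_le_reg_r (INR (S n))); [exact Hn|].
    rewrite Rmult_assoc, Rinv_l, Rmult_1_r by lra.
    eapply Rle_trans; [apply Rabs_triang|].
    assert (H1 : Rabs ((w * E)%S n) <= 1 * (3 ^ S n - 1) / 2).
    { apply mul_bound; [intros; apply cosh_quotient_bound|].
      intros i Hi. rewrite Rmult_1_l. apply IH. lia. }
    assert (H2 : Rabs ((X * (p * deriv E))%S n) <= INR n * 3 ^ S n / 2).
    { destruct n as [|n].
      - rewrite X_mul_0, Rabs_R0. simpl. lra.
      - rewrite X_mul_S.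
        apply Rle_trans with (3 * INR (S n) * (3 ^ S n - 1) / 2).
        + apply mul_bound; [exact Hp|]. intros i Hi. unfold deriv.
          rewrite Rabs_mult, (Rabs_pos_eq (INR (S i))) by apply pos_INR.
          pose proof (IH (S i) ltac:(lia)) as H. simpl pow in H.
          pose proof (le_INR (S i) (S n) ltac:(lia)).
          pose proof (pos_INR (S i)). pose proof (Rabs_pos (E (S i))).
          assert (0 < 3 ^ i) by (apply pow_lt; lra). nra.
        + pose proof (pos_INR (S n)). cbn [pow]. nra. }
    pose proof (pos_INR n). assert (0 < 3 ^ S n) by (apply pow_lt; lra).
    rewrite S_INR in *. nra.
Qed.

Lemma CV_radius_ge (a : nat -> R) x :
  (forall n, Rabs (a n * x ^ n) <= 1) -> Rbar_le x (CV_radius a).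
Proof.
  intros H. destruct (CV_radius_bounded a) as [Hub _]. apply Hub. now exists 1.
Qed.

Lemma CV_radius_ge_third (a : nat -> R) :
  (forall n, Rabs (a n) <= 3 ^ n) -> Rbar_le (1 / 3) (CV_radius a).
Proof.
  intros H. apply CV_radius_ge. intros n. rewrite Rabs_mult, <- RPow_abs.
  replace (Rabs (1 / 3)) with (/ 3) by (rewrite Rabs_pos_eq; lra).
  rewrite pow_inv. assert (0 < 3 ^ n) by (apply pow_lt; lra).
  apply (Rmult_le_reg_r (3 ^ n)); [assumption|].
  rewrite Rmult_assoc, Rinv_l, Rmult_1_r, Rmult_1_l by lra. apply H.
Qed.

Lemma CV_radius_ge_1 (a : nat -> R) :
  (forall n, Rabs (a n) <= 1) -> Rbar_le 1 (CV_radius a).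
Proof.
  intros H. apply CV_radius_ge. intros n. rewrite pow1, Rmult_1_r. apply H.
Qed.

Lemma is_pseries_exps e h : is_pseries (exps e) h (exp (e * h)).
Proof.
  pose proof (is_exp_Reals (e * h)) as H. apply is_pseries_R in H.
  apply is_pseries_R. revert H. apply is_series_ext.
  assert (Heq : forall n, / INR (fact n) * (e * h) ^ n = exps e n * h ^ n).
  { intros n. unfold exps. rewrite Rpow_mult_distr. field. apply INR_fact_neq_0. }
  exact Heq.
Qed.

Lemma PSeries_cosh_quotient h : h <> 0 ->
  PSeries cosh_quotient h = (exp h - 2 + exp (- h)) / h ^ 2.
Proof.
  intros Hh. set (s := PS_plus (exps 1) (exps (-1))).
  assert (Hs : is_pseries s h (exp h + exp (- h))).
  { replace (exp h) with (exp (1 * h)) by (f_equal; ring).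
    replace (exp (- h)) with (exp (-1 * h)) by (f_equal; ring).
    apply (is_pseries_plus (K := R_AbsRing) (V := R_NormedModule));
      apply is_pseries_exps. }
  pose proof (PSeries_decr_n s 1 h (ex_intro _ _ Hs)) as H.
  rewrite (is_pseries_unique _ _ _ Hs) in H.
  rewrite (PSeries_ext (PS_decr_n s 2) cosh_quotient) in H.
  - unfold s, PS_plus, exps, plus in H. simpl in H.
    assert (H' : exp h + exp (- h) = 2 + h ^ 2 * PSeries cosh_quotient h).
    { rewrite H. simpl. field. }
    replace (exp h - 2 + exp (- h)) with (h ^ 2 * PSeries cosh_quotient h) by lra.
    field. exact Hh.
  - intros n. change (PS_decr_n s 2 n) with (exps 1 (S (S n)) + exps (-1) (S (S n))).
    unfold exps, cosh_quotient. replace (n + 2)%nat with (S (S n)) by lia.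
    rewrite pow1. cbn [pow]. field. apply INR_fact_neq_0.
Qed.

Lemma PSeries_tail_cosh_quotient h : Rabs h < 1 -> h <> 0 ->
  PSeries (tail (tail cosh_quotient)) h = (PSeries cosh_quotient h - 1) / h ^ 2.
Proof.
  intros Hh1 Hh.
  rewrite (PSeries_decr_n cosh_quotient 1 h).
  - unfold PS_decr_n. change (fun k => cosh_quotient (2 + k)%nat)
      with (tail (tail cosh_quotient)).
    simpl. replace (cosh_quotient 0%nat) with 1 by (unfold cosh_quotient; simpl; field).
    replace (cosh_quotient 1%nat) with 0 by (unfold cosh_quotient; simpl; field).
    field. exact Hh.
  - apply CV_radius_inside. apply Rbar_lt_le_trans with 1; [exact Hh1|].
    apply CV_radius_ge_1, cosh_quotient_bound.
Qed.

Lemma exp_minus_1_neq_0 x : x <> 0 -> exp x - 1 <> 0.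
Proof.
  intros Hx H. apply Hx, exp_inv. rewrite exp_0. lra.
Qed.

(** With [exp h = 1 + h + h ^ 2 * psi h], the function [mu] is
    [psi h / (1 + h * psi h) - 1 / 2], without singularity. *)
Lemma mu_derivable_0 : ex_derive mu 0.
Proof.
  set (psi := PSeries (fun n => exps 1 (2 + n)%nat)).
  assert (Hexp : forall h, exp h = 1 + h + h ^ 2 * psi h).
  { intros h. pose proof (is_pseries_exps 1 h) as Hs. rewrite Rmult_1_l in Hs.
    pose proof (PSeries_decr_n (exps 1) 1 h (ex_intro _ _ Hs)) as H.
    rewrite (is_pseries_unique _ _ _ Hs) in H.
    unfold psi. unfold PS_decr_n in H. rewrite H. unfold exps. simpl. field. }
  assert (Hpsi : ex_derive psi 0).
  { eexists. apply is_derive_PSeries. rewrite Rabs_R0.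
    apply Rbar_lt_le_trans with 1; [simpl; lra|]. apply CV_radius_ge_1.
    intros n. unfold exps. rewrite pow1. unfold Rdiv. rewrite Rmult_1_l.
    assert (1 <= INR (fact (2 + n))) by (apply (le_INR 1); apply lt_O_fact).
    rewrite Rabs_inv, Rabs_pos_eq by lra. rewrite <- Rinv_1. apply Rinv_le_contravar; lra. }
  assert (Hpsi0 : psi 0 = 1 / 2).
  { unfold psi. rewrite PSeries_0. unfold exps. simpl. field. }
  assert (Hmu : forall h, psi h / (1 + h * psi h) - 1 / 2 = mu h).
  { intros h. unfold mu. destruct (Req_dec_T h 0) as [->|Hh].
    - rewrite Hpsi0. field.
    - pose proof (exp_minus_1_neq_0 h Hh) as H. rewrite Hexp in *.
      assert (1 + h * psi h <> 0) by (intros H1; apply H;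
        replace (1 + h + h ^ 2 * psi h - 1) with (h * (1 + h * psi h)) by ring;
        rewrite H1; ring).
      field. repeat split; trivial. }
  apply (ex_derive_ext _ _ _ Hmu).
  auto_derive. repeat split; trivial. lra.
Qed.

Lemma mu_derive x : x <> 0 ->
  is_derive mu x (- / x ^ 2 + exp x / (exp x - 1) ^ 2).
Proof.
  intros Hx. pose proof (exp_minus_1_neq_0 x Hx).
  apply (is_derive_ext_loc (fun h => / h - / (exp h - 1) - 1 / 2)).
  - assert (Hpos : 0 < Rabs x) by now apply Rabs_pos_lt.
    exists (mkposreal _ Hpos). intros y Hy. unfold mu.
    destruct (Req_dec_T y 0) as [->|]; [exfalso|reflexivity].
    revert Hy. unfold ball. simpl. unfold AbsRing_ball, abs, minus, plus, Hierarchy.opp.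
    simpl. rewrite Rplus_0_l, Rabs_Ropp. lra.
  - auto_derive; [now repeat split|]. field. now split.
Qed.

(** The power series that solves the regular equation and [exp (mu h)] satisfy
    the same linear differential equation of first order away from [0], and both
    take the value [1] at [0]. *)
Lemma PSeries_kernel (E : series) h :
  E 0%nat = 1 ->
  (cosh_quotient * deriv E = - (tail (tail cosh_quotient) * E))%S ->
  (forall n, Rabs (E n) <= 3 ^ n) ->
  Rabs h < 1 / 3 -> PSeries E h = exp (mu h).
Proof.
  intros HE0 HE Hbound Hh.
  pose proof (CV_radius_ge_third E Hbound) as Hrad.
  assert (Hin : forall x, Rabs x < 1 / 3 -> Rbar_lt (Rabs x) (CV_radius E)).
  { intros x Hx. now apply Rbar_lt_le_trans with (1 / 3). }
  assert (Hin1 : forall (a : series) x, (forall n, Rabs (a n) <= 1) ->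
    Rabs x < 1 / 3 -> Rbar_lt (Rabs x) (CV_radius a)).
  { intros a x Ha Hx. apply Rbar_lt_le_trans with 1; [simpl; lra|].
    now apply CV_radius_ge_1. }
  pose (g := fun x => PSeries E x * exp (- mu x)).
  assert (Hg : forall x, Rabs x < 1 / 3 -> x <> 0 -> is_derive g x 0).
  { intros x Hx Hx0.
    pose proof (is_derive_PSeries E x (Hin x Hx)) as HdE.
    pose proof (mu_derive x Hx0) as Hdmu.
    set (q := PSeries cosh_quotient x).
    assert (Hode : q * PSeries (deriv E) x = - ((q - 1) / x ^ 2 * PSeries E x)).
    { unfold q. rewrite <- PSeries_tail_cosh_quotient by (trivial; lra).
      rewrite <- !PSeries_mult; try (apply Hin1; trivial; intros;
        apply cosh_quotient_bound); [|now apply Hin|].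
      - rewrite <- PSeries_opp. apply PSeries_ext. intros n.
        exact (f_equal (fun a => a n) HE).
      - change (deriv E) with (PS_derive E). rewrite CV_radius_derive.
        now apply Hin. }
    assert (Hq : q = (exp x - 1) ^ 2 / (exp x * x ^ 2)).
    { unfold q. rewrite PSeries_cosh_quotient by assumption.
      rewrite exp_Ropp. pose proof (exp_pos x). field. split; lra. }
    pose proof (exp_minus_1_neq_0 x Hx0) as Hex. pose proof (exp_pos x) as Hp.
    assert (HE' : PSeries (deriv E) x
      = (- / x ^ 2 + exp x / (exp x - 1) ^ 2) * PSeries E x).
    { assert (Hq0 : q <> 0).
      { rewrite Hq. unfold Rdiv. apply Rmult_integral_contrapositive_currified.
        - now apply pow_nonzero.
        - apply Rinv_neq_0_compat, Rmult_integral_contrapositive_currified; [lra|].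
          now apply pow_nonzero. }
      apply (Rmult_eq_reg_l q); [|exact Hq0]. rewrite Hode, Hq.
      field. repeat split; trivial; lra. }
    unfold g. change (PS_derive E) with (deriv E) in HdE. auto_derive.
    - repeat split; [exact (ex_intro _ _ HdE)|exact (ex_intro _ _ Hdmu)].
    - change (Derive (fun y => PSeries E y) x) with (Derive (PSeries E) x).
      change (Derive (fun y => mu y) x) with (Derive mu x).
      rewrite (is_derive_unique _ _ _ HdE), (is_derive_unique _ _ _ Hdmu), HE'. ring. }
  (* The quotient [g] has derivative [0] except perhaps at [0], an end point of the
     interval, where continuity is enough. *)
  assert (Hseg : forall x, Rmin 0 h <= x <= Rmax 0 h -> Rabs x < 1 / 3).
  { intros x Hx. revert Hh Hx. unfold Rabs, Rmin, Rmax.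
    destruct (Rle_dec 0 h), (Rcase_abs h), (Rcase_abs x); lra. }
  destruct (MVT_gen g 0 h (fun _ => 0)) as [t [_ Ht]].
  - intros x Hx. apply Hg; [apply Hseg; lra|].
    revert Hx. unfold Rmin, Rmax. destruct (Rle_dec 0 h); lra.
  - intros x Hx. apply continuity_pt_filterlim. apply (ex_derive_continuous g).
    destruct (Req_dec x 0) as [->|Hx0].
    + unfold g. pose proof mu_derivable_0.
      assert (ex_derive (PSeries E) 0)
        by (eexists; apply is_derive_PSeries, Hin; rewrite Rabs_R0; lra).
      auto_derive. repeat split; trivial.
    + eexists. apply Hg; [now apply Hseg|assumption].
  - rewrite Rmult_0_l in Ht.
    assert (Hg0 : g 0 = 1).
    { unfold g, mu. destruct (Req_dec_T 0 0) as [_|]; [|lra].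
      rewrite PSeries_0, HE0, Ropp_0, exp_0. ring. }
    assert (Hgh : g h = 1) by lra. unfold g in Hgh.
    rewrite <- (Rmult_1_r (PSeries E h)).
    replace 1 with (exp (- mu h) * exp (mu h)).
    + rewrite <- Rmult_assoc, Hgh. ring.
    + rewrite <- exp_plus, Rplus_opp_l. apply exp_0.
Qed.

Lemma maclaurin_kernel : exists E : series,
  E 0%nat = 1 /\ kernel_equation E /\
  forall n, E n = maclaurin_coeff (fun h => exp (mu h)) n.
Proof.
  destruct kernel_solution as [E [HE0 [HE Hbound]]].
  exists E. split; [exact HE0|split].
  - unfold kernel_equation.
    transitivity (X * X * (cosh_quotient * deriv E) + cosh_quotient * E)%S; [ring|].
    rewrite HE. rewrite cosh_quotient_tail at 2. ring.
  - intros n. unfold maclaurin_coeff.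
    assert (H3 : 0 < 1 / 3) by lra.
    rewrite (Derive_n_ext_loc _ (PSeries E)).
    + rewrite Derive_n_coef; [field; apply INR_fact_neq_0|].
      apply Rbar_lt_le_trans with (1 / 3); [exact H3|].
      now apply CV_radius_ge_third.
    + exists (mkposreal _ H3). intros y Hy. symmetry.
      apply PSeries_kernel; trivial.
      revert Hy. unfold ball. simpl. unfold AbsRing_ball, abs, minus, plus, Hierarchy.opp.
      simpl. now rewrite Ropp_0, Rplus_0_r.
Qed.

Theorem theorem17 (k : nat) : exists z : Z, INR (fact k) * r k = IZR z.
Proof.
  destruct maclaurin_kernel as [E [HE0 [HE Hcoeff]]].
  destruct (is_integer_scaled_product E HE HE0 k) as [z Hz].
  exists z. rewrite <- Hz. unfold r. rewrite (product_d E k Hcoeff), pow_mult.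
  do 2 f_equal. f_equal. ring.
Qed.
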